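(* The worst-case running time of Zielonka's recursive algorithm on dull parity games, as a function of the number of vertices $|V|$, is $\Omega(2^{|V|/3})$.
   Context: A parity game $G=(V,E,\mathcal{P},(V_\Diamond,V_\Box))$ consists of a finite vertex set $V$ partitioned into $V_\Diamond$ (owned by player even, $\Diamond$) and $V_\Box$ (owned by player odd, $\Box$), a total edge relation $E\subseteq V\times V$ (write $v\to w$) and a priority function $\mathcal{P}:V\to\mathbb{N}$. Player $\Diamond$ wins an infinite play iff the highest priority occurring infinitely often is even; a vertex is won by player $i$ if $i$ has a strategy winning every consistent play from it; solving means computing the winning regions $(W_\Diamond,W_\Box)$. For $A\subseteq V$, $G\setminus A$ is the game restricted to $V\setminus A$. $\overline{i}$ is the opponent of $i$. The $i$-attractor $\mathit{Attr}_i(U)$ of $U\subseteq V$ is the least superset of $U$ closed under adding vertices of $V_i$ having some successor in the set and vertices of $V_{\overline i}$ all of whose successors are in the set. Zielonka's algorithm $\textsc{Zielonka}(G)$: if $V=\emptyset$ return $(\emptyset,\emptyset)$. Otherwise let $m$ be the maximal priority, $p=\Diamond$ if $m$ even else $p=\Box$, $U=\{v\mid\mathcal{P}(v)=m\}$, $A=\mathit{Attr}_p(U)$, $(W'_\Diamond,W'_\Box)=\textsc{Zielonka}(G\setminus A)$. If $W'_{\overline p}=\emptyset$, return $W_p=A\cup W'_p$, $W_{\overline p}=\emptyset$. Otherwise let $B=\mathit{Attr}_{\overline p}(W'_{\overline p})$, $(W''_\Diamond,W''_\Box)=\textsc{Zielonka}(G\setminus B)$, and return $W_p=W''_p$, $W_{\overline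 p}=W''_{\overline p}\cup B$. A basic cycle is a finite path $v_1,\dots,v_n$ with $v_n\to v_1$ and no repeated vertex; it is even (odd) if the highest priority on it is even (odd). A parity game is dull if every even basic cycle is vertex-disjoint from every odd basic cycle. *)

(* Defs.v *)
From mathcomp Require Import all_boot.

Set Implicit Arguments.
Unset Strict Implicit.
Unset Printing Implicit Defensive.

(* A player is identified with the parity of the priorities that favour it:
   [false] is player even, [true] is player odd, and [~~ i] is the opponent
   of [i]. *)
Definition player := bool.

Record parity_game := ParityGame {
  vertex :> finType;
  edge : rel vertex;
  priority : vertex -> nat;
  owner : vertex -> player;
  edge_total : forall v, exists w, edge v w
}.

Section Dull.
Variable G : parity_game.

(* [ucycle] accepts the empty sequence, which is not a basic cycle. *)
Definition basic_cycle (c : seq G) : Prop := c <> [::] /\ ucycle (@edge G) c.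

Definition cycle_parity (c : seq G) : player := odd (\max_(v <- c) priority v).

Definition dull : Prop :=
  forall c d : seq G, basic_cycle c -> basic_cycle d ->
    cycle_parity c = false -> cycle_parity d = true -> [disjoint c & d].

End Dull.

(* The subgames met by the algorithm are represented by their vertex set
   [S : {set G}]: the full game is [setT] and, for a subgame [S], the game
   S \ A is [S :\: A]. *)
Section Zielonka.
Variable G : parity_game.
Implicit Types (S U X : {set G}) (i : player).

Definition attr_closed S i X : bool :=
  [forall (v | v \in S),
    (if owner v == i then [exists (w | w \in S), edge v w && (w \in X)]
     else [forall (w | w \in S), edge v w ==> (w \in X)]) ==> (v \in X)].

Definition attr S i U : {set G} :=
  \bigcap_(X : {set G} | (U \subset X) && attr_closed S i X) X.

(* The winning regions, indexed by the players, with the running time. *)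
Definition outcome := ((player -> {set G}) * nat)%type.

(* [cost S] is the time an invocation on [S] spends outside of its recursive
   calls (computing attractors, set operations, ...); it depends on the
   implementation. When it is constantly 1, the running time is the number of
   invocations. *)
Variable cost : {set G} -> nat.

Definition zielonka_body (rec : {set G} -> outcome) S : outcome :=
  if S == set0 then (fun=> set0, cost S) else
  let m := (\max_(v in S) priority v) in
  let p := odd m in
  let U := [set v in S | priority v == m] in
  let A := attr S p U in
  let (W1, t1) := rec (S :\: A) in
  if W1 (~~ p) == set0 then
    (fun i => if i == p then A :|: W1 p else set0, (cost S + t1))
  else
    let B := attr S (~~ p) (W1 (~~ p)) in
    let (W2, t2) := rec (S :\: B) in
    (fun i => if i == p then W2 p else W2 (~~ p) :|: B,
     (cost S + t1 + t2)).

(* Recursive calls are made on strictly smaller sets, so that a recursion depth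
   of [#|S|.+1] is enough and the initial value of the iteration is never used:
   see [zielonkaE]. *)
Definition zielonka S : outcome :=
  iter #|S|.+1 zielonka_body (fun=> (fun=> set0, 0)) S.

Lemma sub_attr S i U : U \subset attr S i U.
Proof. by apply/bigcapsP => X /andP[]. Qed.

Lemma attr_sub S i U : U \subset S -> attr S i U \subset S.
Proof.
move=> US; apply: bigcap_inf; rewrite US /=.
by apply/forall_inP => v vS; rewrite vS implybT.
Qed.

Lemma ltn_setD_attr S i U : U \subset S -> U != set0 ->
  (#|S :\: attr S i U| < #|S|).
Proof.
move=> US /set0Pn[v vU]; apply: proper_card; apply/properP.
split; first exact: subsetDl.
exists v; first exact: (subsetP US).
by rewrite inE (subsetP (sub_attr S i U) v vU).
Qed.

Lemma max_priority_neq0 S : S != set0 ->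
  [set v in S | priority v == (\max_(w in S) priority w)] != set0.
Proof.
move=> /set0Pn[v vS]; apply/set0Pn.
have S0 : (0 < #|S|) by apply/card_gt0P; exists v.
case: (eq_bigmax_cond (@priority G) S0) => w wS ->.
by exists w; rewrite inE wS eqxx.
Qed.

Lemma zielonka_body_eq (f g : {set G} -> outcome) S :
  (forall S' i, (#|S'| < #|S|) -> (f S').1 i \subset S') ->
  (forall S', (#|S'| < #|S|) -> f S' = g S') ->
  zielonka_body f S = zielonka_body g S.
Proof.
move=> fS fg; rewrite /zielonka_body; case: eqP => // /eqP S0.
set m := (\max_(v in S) priority v).
set A := attr S (odd m) _.
have ltA : (#|S :\: A| < #|S|).
  apply: ltn_setD_attr; last exact: max_priority_neq0.
  by apply/subsetP => v; rewrite inE => /andP[].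
rewrite -(fg _ ltA); have := fS _ (~~ odd m) ltA.
case: (f _) => W1 t1 /= W1S; case: eqP => // /eqP W10.
rewrite -fg //; apply: ltn_setD_attr => //.
exact: subset_trans W1S (subsetDl _ _).
Qed.

Lemma zielonka_iter_sub (k : nat) S i :
  (iter k zielonka_body (fun=> (fun=> set0, 0)) S).1 i \subset S.
Proof.
elim: k S i => [|k IH] S i /=; first exact: sub0set.
rewrite {1}/zielonka_body; case: eqP => [_|_]; first exact: sub0set.
set m := (\max_(v in S) priority v).
set A := attr S (odd m) _.
have AS : A \subset S.
  by apply: attr_sub; apply/subsetP => v; rewrite inE => /andP[].
have := IH (S :\: A); case: (iter _ _ _ _) => W1 t1 /= W1S.
have {}W1S j : W1 j \subset S := subset_trans (W1S j) (subsetDl _ _).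
case: eqP => _ /=.
  by case: ifP => _; rewrite ?sub0set // subUset AS W1S.
set B := attr S _ _; have BS : B \subset S by exact: attr_sub.
have := IH (S :\: B); case: (iter _ _ _ _) => W2 t2 /= W2S.
have {}W2S j : W2 j \subset S := subset_trans (W2S j) (subsetDl _ _).
by case: ifP => _; rewrite ?subUset ?W2S.
Qed.

Lemma zielonka_iter_eq (k k' : nat) S : #|S| < k -> #|S| < k' ->
  iter k zielonka_body (fun=> (fun=> set0, 0)) S =
  iter k' zielonka_body (fun=> (fun=> set0, 0)) S.
Proof.
elim: k k' S => [//|k IH] [//|k'] S Sk Sk'; rewrite !iterS.
apply: zielonka_body_eq => [S' i _|S' S'S]; first exact: zielonka_iter_sub.
by apply: IH; apply: leq_trans S'S _.
Qed.

Lemma zielonkaE S : zielonka S = zielonka_body zielonka S.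
Proof.
rewrite {1}/zielonka iterS; apply: zielonka_body_eq => [S' i _|S' S'S].
  exact: zielonka_iter_sub.
exact: zielonka_iter_eq.
Qed.

Definition running_time : nat := (zielonka setT).2.

End Zielonka.

(* Imported only now: [set0], [setT] and [subsetP] above are those of finset
   and fintype, which classical_sets shadows. *)
From mathcomp Require Import all_order all_algebra.
From mathcomp Require Import all_classical all_reals all_analysis.

Import Order.TTheory GRing.Theory Num.Theory.

Local Open Scope classical_set_scope.
Local Open Scope ring_scope.

(* The supremum over all dull games with [n] vertices; there are infinitely
   many of them, as the priorities are unbounded, so it is taken in [\bar R]. *)
Definition worst_case_dull (R : realType)
    (cost : forall G : parity_game, {set G} -> nat) (n : nat) : \bar R :=
  ereal_sup [set t | exists G : parity_game,
    [/\ #|G| = n, dull G & t = ((running_time (cost G))%:R)%:E]].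

Definition is_Omega (R : realType) (f : nat -> \bar R) (g : nat -> R) : Prop :=
  exists c : R, 0 < c /\
    exists N : nat, forall n : nat, (N <= n)%N -> ((c * g n)%:E <= f n)%E.

(* Main.v *)
(* The hard games are descending paths 0 <- 1 <- 2 <- ... whose even vertices
   carry a self-loop. The self-loops are the only cycles, so the games are dull.
   Vertices 2l and 2l+1 form level l and belong to player l mod 2; the loop at
   2l favours the other player, and 2l+1 has the maximal priority among the
   levels >= l, of parity l mod 2. On the levels >= l the algorithm first
   removes only 2l+1 and recurses on the levels >= l+1, together with the loop
   at 2l. There the opponent wins 2l but nothing of the levels >= l+1; his
   attractor of 2l consists of the levels l and l+1, so the second recursive
   call is on the levels >= l+2. Hence the number of invocations grows at least
   like the Fibonacci numbers in n/2, and since F(h+3) >= 4 F(h) it is at least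
   of order 4^(n/6) = 2^(n/3). *)
Require Import Defs.
From mathcomp Require Import all_boot zify.

Set Implicit Arguments.
Unset Strict Implicit.
Unset Printing Implicit Defensive.

(** * Attractors as least closed sets *)

Section Attractor.
Variable G : parity_game.
Implicit Types (S U X : {set G}) (i : player).

Lemma attr_closedP S i X : reflect
  {in S, forall v,
    (owner v = i -> forall w, w \in S -> edge v w -> w \in X -> v \in X) /\
    (owner v != i -> {in S, forall w, edge v w -> w \in X} -> v \in X)}
  (attr_closed S i X).
Proof.
apply: (iffP forall_inP) => H v vS.
- have /implyP := H v vS; case: eqP => [ov|ov] {}H; split => //.
  + by move=> _ w wS vw wX; apply: H; apply/exists_inP; exists w; rewrite ?vw.
  + by move=> _ K; apply: H; apply/forall_inP => w wS; apply/implyP/K.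
- have [H1 H2] := H v vS; apply/implyP; case: eqP => [ov|/eqP ov].
  + by case/exists_inP => w wS /andP[vw wX]; apply: (H1 ov w).
  + by move/forall_inP => K; apply: H2 => // w wS; apply/implyP/K.
Qed.

Lemma attr_eq S i U X : U \subset X -> attr_closed S i X ->
  (forall Y : {set G}, U \subset Y -> attr_closed S i Y -> X \subset Y) ->
  attr S i U = X.
Proof.
move=> UX Xc Xmin; apply/eqP; rewrite eqEsubset; apply/andP; split.
  by apply: bigcap_inf; rewrite UX.
by apply/bigcapsP => Y /andP[]; apply: Xmin.
Qed.

End Attractor.

(** * The path games and their dullness *)

Section PathGame.
Variable n : nat.

Definition path_edge : rel 'I_n :=
  fun i j => (i == j.+1 :> nat) || ~~ odd i && (i == j).

(** Since [n.*2] is even, the odd vertex of level l gets the parity of l. These priorities decrease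
    with the level but stay above those of the loops, which are 0 or 1. *)
Definition path_priority (i : 'I_n) : nat :=
  if odd i then n.*2 - i./2 else ~~ odd i./2.

Lemma path_edge_total (i : 'I_n) : exists j, path_edge i j.
Proof.
have [oi|ei] := boolP (odd i); last by exists i; rewrite /path_edge ei eqxx orbT.
have lt_i : i.-1 < n by have := ltn_ord i; lia.
by exists (Ordinal lt_i); apply/orP; left => /=; lia.
Qed.

Definition path_game : parity_game :=
  @ParityGame 'I_n path_edge path_priority (fun i => odd i./2) path_edge_total.

Lemma path_game_card : #|path_game| = n.
Proof. exact: card_ord. Qed.

(** Edges never increase the index, so on a cycle any two indices bound each other and are equal. *)
Lemma path_game_basic_cycle (c : seq path_game) :
  basic_cycle c -> exists v : 'I_n, c = [:: v].
Proof.
case=> c0 /andP[cyc unq].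
have : cycle (fun v w : 'I_n => w <= v) c.
  by apply: sub_cycle cyc => v w /orP[/eqP ->|/andP[_ /eqP ->]] //=.
rewrite cycle_all2rel; last by move=> v u w vu wv; apply: leq_trans wv vu.
case: c c0 unq {cyc} => [//|v [|w c]] _ unq le_c; first by exists v.
have [wv vw] : w <= v /\ v <= w.
  by split; apply: (allrelP le_c); rewrite !inE eqxx ?orbT.
by move: unq; rewrite /= inE -val_eqE eqn_leq wv vw.
Qed.

Lemma path_game_dull : dull path_game.
Proof.
move=> c d /path_game_basic_cycle[v ->] /path_game_basic_cycle[w ->].
rewrite /cycle_parity !big_seq1 => pv pw; rewrite disjoint_has /= orbF inE.
by apply: contraFN pv => /eqP ->; rewrite pw.
Qed.

Variable cost : {set path_game} -> nat.
Hypothesis cost_gt0 : forall S, 0 < cost S.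
Implicit Types (S X : {set 'I_n}) (v w : 'I_n).

(** * Sets of isolated loops *)

(** Two even vertices are never consecutive, so self-loops are the only edges inside [S]. *)
Lemma attr_isolated S i X : {in S, forall v, ~~ odd v} -> X \subset S ->
  attr (S : {set path_game}) i X = X.
Proof.
move=> evS XS; apply: attr_eq => //; apply/attr_closedP => v vS; split => _.
- move=> w wS; rewrite /= /path_edge => /orP[|/andP[_ /eqP ->]//].
  by have := evS _ vS; have := evS _ wS; lia.
- by apply=> //; rewrite /= /path_edge evS //= eqxx orbT.
Qed.

Lemma zielonka_isolated S i : {in S, forall v, ~~ odd v} ->
  (zielonka cost S).1 i = [set v in S | ~~ odd v./2 == i].
Proof.
have [k] := ubnP #|S|; elim: k S i => [//|k IH] S i /ltnSE leSk evS.
rewrite zielonkaE /zielonka_body; case: eqP => [->|/eqP S0].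
  by apply/setP => v; rewrite !inE.
have priS v : v \in S -> path_priority v = ~~ odd v./2.
  by move=> vS; rewrite /path_priority (negPf (evS v vS)).
have [w wS] : exists2 w, w \in S &
    \max_(v in (S : {set path_game})) priority v = ~~ odd w./2.
  rewrite -card_gt0 in S0; have [w wS ->] := eq_bigmax_cond path_priority S0.
  by exists w => //; apply: priS.
have [p wp] : exists p, ~~ odd w./2 = p by exists (~~ odd w./2).
rewrite wp => ->; rewrite oddb.
set U := [set v in _ | _].
have UE : U = [set v in S | ~~ odd v./2 == p].
  apply/setP => v; rewrite !inE; case: (boolP (v \in S)) => //= vS.
  by rewrite priS //; case: (odd _) (p) => [] [].
have US : U \subset S by rewrite UE; apply/subsetP => v; rewrite inE => /andP[].
rewrite (attr_isolated _ evS US).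
have U0 : U != set0 by apply/set0Pn; exists w; rewrite UE inE wS wp eqxx.
have evSU : {in S :\: U, forall v, ~~ odd v}.
  by move=> v; rewrite inE => /andP[_ /evS].
have ltSU : #|S :\: U| < k.
  apply: leq_trans leSk; rewrite cardsDS // ltn_subrL.
  by rewrite !card_gt0 U0.
have {}IH1 j := IH _ j ltSU evSU.
case E1: (zielonka cost _) IH1 => [W1 t1] /= W1E.
(* The loops outside [U] all favour the opponent of [p]; if there are any, the second call is
   therefore on [U]. *)
have W1N : W1 (~~ p) = S :\: U.
  rewrite W1E UE; apply/setP => v; rewrite !inE.
  by case: (v \in S); case: (odd _) (p) => [] [].
rewrite W1N; case: ifP => [/eqP/setP SU0|/negbT SU0] /=.
  rewrite W1E UE in SU0 *; apply/setP => v; have := SU0 v.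
  by case: eqP => [->|]; rewrite !inE; case: (v \in S); case: (odd _) (p) i => [] [] [].
rewrite (attr_isolated _ evS) ?subsetDl // setDDr setDv set0U (setIidPr US).
have ltU : #|U| < k.
  apply: leq_trans leSk; apply: proper_card; rewrite properEneq US andbT.
  by apply: contraNneq SU0 => ->; rewrite setDv.
have evU : {in U, forall v, ~~ odd v} by move=> v /(subsetP US)/evS.
have {}IH2 j := IH _ j ltU evU.
case E2: (zielonka cost _) IH2 => [W2 t2] /= W2E.
rewrite !W2E UE; apply/setP => v.
by case: eqP => [->|]; rewrite !inE; case: (v \in S); case: (odd _) (p) i => [] [] [].
Qed.

(** * Runs of the algorithm on the upper levels *)

(* The even vertices below [l.*2] in [S] are isolated loops left over from the
   levels already processed. *)
Definition path_state (l : nat) S : Prop :=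
  forall v, (l.*2 <= v -> v \in S) /\ (v \in S -> odd v -> l.*2 <= v).

(** A leftover loop goes to the player it favours; all levels from [l] on go to the player favoured
    by the loop at [l.*2]. *)
Definition path_winner (l : nat) v : player := ~~ odd (minn l v./2).

Lemma path_state_max l S : l < n./2 -> path_state l S ->
  \max_(v in (S : {set path_game})) priority v = n.*2 - l.
Proof.
move=> ltl Sl; have ltv : l.*2.+1 < n by lia.
apply/eqP; rewrite eqn_leq; apply/andP; split.
  apply/bigmax_leqP => v vS /=; rewrite /path_priority; case: ifP => ov.
    by have [_ /(_ vS ov)] := Sl v; lia.
  by case: (~~ odd _) => /=; lia.
have -> : n.*2 - l = path_priority (Ordinal ltv).
  by rewrite /path_priority /=; case: ifP; lia.
apply: (@leq_bigmax_cond _ (mem (S : {set path_game})) path_priority).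
by apply: (Sl _).1 => /=; lia.
Qed.

(** Only [l.*2 + 2] can have an edge to this vertex, and its owner, the opponent, can stay on the
    loop there. *)
Lemma path_state_attr_max l S (ltv : l.*2.+1 < n) : path_state l S ->
  attr (S : {set path_game}) (odd l) [set Ordinal ltv] = [set Ordinal ltv].
Proof.
move=> Sl; apply: attr_eq => //; apply/attr_closedP => v vS.
have [Sge Sodd] := Sl v; rewrite /=; split => [ov w wS vw|/eqP ov K].
  rewrite !inE -!val_eqE /= => /eqP wl; case/orP: vw => [/eqP vw|/andP[ev /eqP vw]].
    by rewrite vw wl in ov; lia.
  by rewrite vw wl /= in ev; lia.
have [oddv|ev] := boolP (odd v); last first.
  by apply: K => //; rewrite /path_edge ev eqxx orbT.
have gev := Sodd vS oddv; have ltw : v.-1 < n by have := ltn_ord v; lia.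
have : Ordinal ltw \in [set Ordinal ltv].
  apply: K; first by apply: (Sl _).1 => /=; lia.
  by apply/orP; left => /=; lia.
by rewrite !inE -!val_eqE /=; lia.
Qed.

(** The attraction stops below [l.*2 + 4], whose owner is player l mod 2 and can stay on its
    loop. *)
Lemma path_state_attr_opponent l S X : path_state l S ->
  l.*2.+1 < n ->
  (forall v, (v \in X) = [&& v \in S, v < l.*2.+1 & odd v./2 == odd l]) ->
  attr (S : {set path_game}) (~~ odd l) X =
  [set v in S | if v < l.*2 then odd v./2 == odd l else v < l.*2 + 4].
Proof.
move=> Sl ltv XE; apply: attr_eq.
- apply/subsetP => v; rewrite XE inE => /and3P[-> ltvl ->] /=.
  by case: ifP => //; lia.
- apply/attr_closedP => v vS; have [Sge Sodd] := Sl v; rewrite /=; split.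
  + move=> ov w wS vw; rewrite !inE vS wS /=.
    case/orP: vw => [/eqP vw|/andP[ev /eqP ->//]].
    have [_ Soddw] := Sl w; have {}Soddw := Soddw wS.
    have [ow|ew] := boolP (odd w).
      have {}Soddw := Soddw ow; case: ifP; case: ifP; lia.
    have := Sodd vS; case: ifP; case: ifP; lia.
  + move=> /eqP ov K.
    have [oddv|ev] := boolP (odd v); last first.
      by apply: K => //; rewrite /path_edge ev eqxx orbT.
    have gev := Sodd vS oddv; have ltw : v.-1 < n by have := ltn_ord v; lia.
    have /K : Ordinal ltw \in S by apply: (Sl _).1 => /=; lia.
    rewrite !inE /= vS /path_edge /= => K1.
    have /K1 : (v == v.-1.+1 :> nat) || ~~ odd v && (v == Ordinal ltw) by lia.
    by case/andP => _; case: ifP; case: ifP; lia.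
- move=> Y XY /attr_closedP Yc.
  (* Climb from [l.*2], which lies in [X]: the next vertex has no other successor, and those of
     level l+1 belong to the attracting player. *)
  have SY (w : 'I_n) : w = l.*2 :> nat -> w \in Y.
    move=> wl; apply: (subsetP XY); rewrite XE (Sl _).1 ?wl //=; lia.
  have S1Y (w : 'I_n) : w = l.*2.+1 :> nat -> w \in Y.
    move=> wl; have wS : w \in S by apply: (Sl _).1; lia.
    have [_] := Yc _ wS; apply => /=; first by apply/eqP; lia.
    move=> u uS /orP[/eqP wu|/andP[]]; [apply: SY|]; lia.
  have step (w : 'I_n) : l.*2 + 2 <= w < l.*2 + 4 ->
      (forall u : 'I_n, u.+1 = w :> nat -> u \in Y) -> w \in Y.
    move=> wl uY; have wS : w \in S by apply: (Sl _).1; lia.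
    have ltw : w.-1 < n by have := ltn_ord w; lia.
    have [H _] := Yc _ wS; apply: (H _ (Ordinal ltw)) => /=.
    + by lia.
    + by apply: (Sl _).1 => /=; lia.
    + by apply/orP; left => /=; lia.
    + by apply: uY => /=; lia.
  have S2Y (w : 'I_n) : w = l.*2 + 2 :> nat -> w \in Y.
    by move=> wl; apply: step => [|u ul]; [lia|apply: S1Y; lia].
  apply/subsetP => v; rewrite inE => /andP[vS].
  case: ifP => vl.
    by move=> ov; apply: (subsetP XY); rewrite XE vS ov; lia.
  move=> vl4; have [v0|v0] := eqVneq (v : nat) l.*2; first exact: SY.
  have [v1|v1] := eqVneq (v : nat) l.*2.+1; first exact: S1Y.
  have [v2|v2] := eqVneq (v : nat) (l.*2 + 2); first exact: S2Y.
  by apply: step => [|u ul]; [lia|apply: S2Y; lia].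
Qed.

(** The Fibonacci numbers F(h+2), where F(1) = F(2) = 1. *)
Fixpoint fib (h : nat) : nat :=
  if h is h1.+1 then if h1 is h2.+1 then fib h1 + fib h2 else 2 else 1.

Lemma zielonka_time_gt0 S : 0 < (zielonka cost S).2.
Proof.
rewrite zielonkaE /zielonka_body; case: ifP => _ //=.
case: zielonka => W1 t1; case: ifP => _ /=; first by rewrite addn_gt0 cost_gt0.
by case: zielonka => W2 t2 /=; rewrite !addn_gt0 cost_gt0.
Qed.

(** The winning regions are carried along with the time because they determine the second recursive
    call. *)
Lemma zielonka_path_state l S : path_state l S ->
  (forall i, (zielonka cost S).1 i = [set v in S | path_winner l v == i]) /\
  fib (n./2 - l) <= (zielonka cost S).2.
Proof.
have [k] := ubnP (n./2 - l); elim: k l S => [//|k IH] l S /ltnSE lek Sl.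
(* Without a complete level from [l] on, only loops are left; for odd [n] the top level is a lone
   loop. *)
have [lel|ltl] := leqP n./2 l.
  have evS : {in S, forall v, ~~ odd v}.
    move=> v vS; apply/negP => ov; have [_ /(_ vS ov)] := Sl v.
    by have := ltn_ord v; lia.
  split=> [i|].
    rewrite zielonka_isolated //; apply/setP => v; rewrite !inE /path_winner.
    by rewrite (minn_idPr _) //; have := ltn_ord v; lia.
  by rewrite (eqP lel) zielonka_time_gt0.
have ltv : l.*2.+1 < n by lia.
have S0 : S != set0.
  by apply/set0Pn; exists (Ordinal ltv); apply: (Sl _).1 => /=; lia.
rewrite zielonkaE /zielonka_body (negPf S0) (path_state_max ltl Sl).
have -> : odd (n.*2 - l) = odd l by lia.
have -> : [set v in (S : {set path_game}) | priority v == n.*2 - l] =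
    [set Ordinal ltv].
  apply/setP => v; rewrite !inE -val_eqE /= /path_priority.
  have [Sge Sodd] := Sl v; have := ltn_ord v.
  have [vS|vS] := boolP (v \in S); last by have := contra Sge vS; lia.
  by case: ifP => /= ov; [have := Sodd vS ov|case: odd]; lia.
rewrite path_state_attr_max //.
set S1 := S :\: _; have S1l : path_state l.+1 S1.
  move=> v; have [Sge Sodd] := Sl v; rewrite !inE -val_eqE /=; split.
    by move=> vl; rewrite Sge; lia.
  by case/andP => v0 vS ov; have := Sodd vS ov; lia.
have [||W1E T1] := IH l.+1 S1; [lia|by []|].
case E1: (zielonka cost _) W1E T1 => [W1 t1] /= W1E T1.
(* In state l+1, player l mod 2 wins all levels from l+1 on, so the opponent is left with loops up
   to [l.*2]. *)
have W1N v : (v \in W1 (~~ odd l)) =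
    [&& v \in S, v < l.*2.+1 & odd v./2 == odd l].
  rewrite W1E !inE -val_eqE /= /path_winner.
  by case: (v \in S) => /=; lia.
have -> : (W1 (~~ odd l) == set0) = false.
  have ltv' := ltnW ltv; apply/negbTE/set0Pn; exists (Ordinal ltv').
  by rewrite W1N (Sl _).1 /=; lia.
rewrite (path_state_attr_opponent Sl ltv W1N).
set B := [set v in S | _]; set S2 := S :\: B.
have S2l : path_state l.+2 S2.
  move=> v; have [Sge Sodd] := Sl v; rewrite !inE; split.
    by move=> vl; rewrite Sge //=; [case: ifP|]; lia.
  by case/andP => vB vS ov; move: vB (Sodd vS ov); rewrite vS /=; case: ifP; lia.
have [||W2E T2] := IH l.+2 S2; [lia|by []|].
case E2: (zielonka cost _) W2E T2 => [W2 t2] /= W2E T2; split=> [i|].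
  apply/setP => v; case: eqP => [->|/eqP il]; rewrite !W2E !inE /path_winner.
    by case: (v \in S) => //=; case: ifP; lia.
  by case: (v \in S) => //=; case: ifP; lia.
have := cost_gt0 S; move: T1 T2.
have -> : n./2 - l = (n./2 - l.+1).+1 by lia.
(* At the last complete level the predecessor is truncated: both calls meet only loops, and [fib 1]
   is [fib 0 + fib 0]. *)
have -> : n./2 - l.+2 = (n./2 - l.+1).-1 by lia.
by case: (n./2 - l.+1) => [|h] /=; lia.
Qed.

Lemma running_time_path_game : fib n./2 <= running_time cost.
Proof.
have [|_] := @zielonka_path_state 0 setT; last by rewrite subn0.
by move=> v; rewrite in_setT.
Qed.

End PathGame.

(** * Exponential growth and the lower bound *)

(** Both sides obey the Fibonacci recurrence, so the cases 0 and 1 suffice: 4 <= 5 and 8 <= 8. *)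
Lemma fib_add3 h : 4 * fib h <= fib h.+3.
Proof.
elim: h {-2}h (leqnn h) => [|k IH] [|[|h]] //= hk.
have := IH h; have := IH h.+1; rewrite /=; lia.
Qed.

Lemma exp4_le_fib h : 4 ^ (h %/ 3) <= fib h.
Proof.
elim: h {-2}h (leqnn h) => [|k IH] [|[|[|h]]] // hk.
apply: leq_trans (fib_add3 h); rewrite -[h.+3]addn3 divnDr // divnn addn1 expnS.
by rewrite leq_mul2l IH //; lia.
Qed.

From mathcomp Require Import all_order all_algebra.
From mathcomp Require Import all_classical all_reals all_analysis.
Import Order.TTheory GRing.Theory Num.Theory.

Local Open Scope ring_scope.

Theorem theorem4 (R : realType)
    (cost : forall G : parity_game, {set G} -> nat)
    (cost_gt0 : forall (G : parity_game) (S : {set G}), (0 < cost G S)%N) :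
  is_Omega (worst_case_dull R cost) (fun n : nat => (2 : R) `^ (n%:R / 3)).
Proof.
(* The factor pays for rounding: with h = n div 6, n/3 <= 2(h+1), so 2^(n/3) is at most 4 * 4^h. *)
exists 4^-1; split; first by rewrite invr_gt0 ltr0n.
exists 0%N => n _; apply: le_trans (ereal_sup_ubound _); last first.
  by exists (path_game n); split; [exact: path_game_card|exact: path_game_dull|].
rewrite lee_fin ler_pdivrMl ?ltr0n //.
set h := (n./2 %/ 3)%N.
have le_exp : n%:R / 3 <= (2 * h.+1)%:R :> R.
  by rewrite ler_pdivrMr ?ltr0n // -natrM ler_nat /h; lia.
apply: le_trans (ler_powR _ le_exp) _; first by rewrite ler1n.
rewrite powR_mulrn ?ler0n // -natrX -natrM ler_nat expnM expnS leq_mul2l /=.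
exact: leq_trans (exp4_le_fib _) (running_time_path_game (cost_gt0 _)).
Qed.
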